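(* Let $(X,D,P)$ be a complete perturbed metric space with exact metric $d=D-P$, and let $M\ge 1$ be a constant such that $D(x,y)\le M\,d(x,y)$ for all $x,y\in X$. Let $T:X\to X$ and $a,b,c,h,e\ge 0$ be such that for all $x,y\in X$ $$D(Tx,Ty)\le a\,D(x,y)+b\,D(x,Tx)+c\,D(y,Ty)+h\,D(x,Ty)+e\,D(y,Tx),$$ and suppose $M(a+b+c+h+e)<1$. Put $A=Ma$, $B=Mb$, $C=Mc$, $H=Mh$, $E=Me$ and $$\kappa:=\frac{2A+B+C+H+E}{2-(B+C+H+E)}.$$ Then $\kappa\in[0,1)$, $T$ has a unique fixed point $x^\ast\in X$, and for every $x_0\in X$ the Picard sequence $x_{n+1}=Tx_n$ ($n\ge 0$) converges to $x^\ast$ in $(X,d)$ and satisfies $d(x_n,x_{n+1})\le\kappa^{\,n}\,d(x_0,x_1)$ for all $n\ge 0$.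
   Context: A perturbed metric space $(X,D,P)$ consists of a nonempty set $X$ and two functions $D,P:X\times X\to[0,\infty)$ such that $d(x,y):=D(x,y)-P(x,y)$ is a metric on $X$, called the exact metric. Neither $D$ nor $P$ is assumed symmetric. $(X,D,P)$ is called complete if the metric space $(X,d)$ is complete. *)

(* Defs.v *)
From HB Require Import structures.
From mathcomp Require Import all_boot all_order all_algebra.
From mathcomp Require Import boolp classical_sets reals topology.

Set Implicit Arguments.
Unset Strict Implicit.
Unset Printing Implicit Defensive.
Import Order.TTheory GRing.Theory Num.Theory.
Local Open Scope classical_set_scope.
Local Open Scope ring_scope.

(* Nonnegativity of d is omitted, as in the library's factory isMetric: it
   follows from these four axioms. *)
Record is_metric (R : realType) (X : Type) (d : X -> X -> R) : Prop := IsMetric {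
  is_metric_refl : forall x, d x x = 0 ;
  is_metric_eq0 : forall x y, d x y = 0 -> x = y ;
  is_metric_sym : forall x y, d x y = d y x ;
  is_metric_triangle : forall y x z, d x z <= d x y + d y z
}.

(* [pdist] and [perturb] are the functions D and P of a space (X, D, P). *)
Record perturbedMetricSpace (R : realType) := PerturbedMetricSpace {
  pm_sort :> Type ;
  pm_nonempty : inhabited pm_sort ;
  pdist : pm_sort -> pm_sort -> R ;
  perturb : pm_sort -> pm_sort -> R ;
  pdist_ge0 : forall x y, 0 <= pdist x y ;
  perturb_ge0 : forall x y, 0 <= perturb x y ;
  exact_is_metric : is_metric (fun x y => pdist x y - perturb x y)
}.

Definition exact_dist (R : realType) (X : perturbedMetricSpace R) (x y : X) : R :=
  pdist x y - perturb x y.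

(* The topology and uniformity of a perturbed metric space are those of its
   exact metric, so that [-->] and [cauchy] on X refer to (X, exact_dist). *)
HB.instance Definition _ (R : realType) (X : perturbedMetricSpace R) :=
  gen_eqMixin (pm_sort X).
HB.instance Definition _ (R : realType) (X : perturbedMetricSpace R) :=
  gen_choiceMixin (pm_sort X).
HB.instance Definition _ (R : realType) (X : perturbedMetricSpace R) :=
  @isMetric.Build R (pm_sort X) (@exact_dist R X)
    (is_metric_refl (exact_is_metric X))
    (is_metric_eq0 (exact_is_metric X))
    (is_metric_sym (exact_is_metric X))
    (is_metric_triangle (exact_is_metric X)).

(* Sequential completeness. The library's completeType asks for the convergence
   of all Cauchy filters on a pointed type. *)
Definition pm_complete (R : realType) (X : perturbedMetricSpace R) : Prop :=
  forall u : nat -> X, cauchy (u @ \oo) -> exists l : X, u @ \oo --> l.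

(* Main.v *)
(** Since [D] dominates the exact metric [d] and [D <= M d], the map [T]
    satisfies the Hardy-Rogers inequality for [d] with the coefficients
    [A, ..., E], whose sum is less than 1. Adding the inequality for
    [(x, T x)] to the one for [(T x, x)] gives
    [d(T x, T (T x)) <= kappa d(x, T x)], so Picard sequences are Cauchy; passing
    to the limit in the inequality shows that the limit is fixed. *)
Require Import Defs.
From mathcomp Require Import all_boot all_order all_algebra.
From mathcomp Require Import boolp classical_sets reals topology.
From mathcomp Require Import normedtype sequences lra.
Import Order.TTheory GRing.Theory Num.Theory.
Import numFieldNormedType.Exports.
Local Open Scope classical_set_scope.
Local Open Scope ring_scope.

(** The bound is the tail of the geometric series; the induction on [m] closes because
    [r + k * (r / (1 - k)) = r / (1 - k)]. *)
Lemma geometric_dist_le {R : realFieldType} {X : metricType R} {u : nat -> X}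
    {k r : R} :
  0 <= k < 1 -> 0 <= r ->
  (forall n, mdist (u n) (u n.+1) <= k ^+ n * r) ->
  forall n m, mdist (u n) (u (n + m)%N) <= k ^+ n * (r / (1 - k)).
Proof.
move=> /andP[k0 k1] r0 hu n m; have k1' : 0 < 1 - k by rewrite subr_gt0.
elim: m n => [|m IH] n.
  by rewrite addn0 mdistxx mulr_ge0 ?exprn_ge0// divr_ge0// ltW.
rewrite addnS -addSn (le_trans (metric_triangle _ (u n.+1) _))//.
rewrite (le_trans (lerD (hu n) (IH n.+1)))//.
rewrite exprSr -mulrA -mulrDr ler_wpM2l ?exprn_ge0//.
by rewrite -[X in X + _](divfK (lt0r_neq0 k1')) mulrC -mulrDl subrK mul1r.
Qed.

Lemma geometric_cauchy {R : realType} {X : metricType R} {u : nat -> X}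
    {k r : R} :
  0 <= k < 1 -> (forall n, mdist (u n) (u n.+1) <= k ^+ n * r) ->
  cauchy (u @ \oo).
Proof.
move=> /[dup] hk /andP[k0 k1] hu.
(* The case [n = 0] of the hypothesis forces the sign of [r]. *)
have r0 : 0 <= r by have := hu 0; rewrite expr0 mul1r; apply/le_trans/mdist_ge0.
apply: cauchy_exP => eps eps0.
(* The summand 1 keeps the divisor of [eps] positive even when [r = 0]. *)
have q0 : 0 < r / (1 - k) + 1 by rewrite ltr_wpDl// divr_ge0// subr_ge0 ltW.
have /cvg_ballP/(_ _ (divr_gt0 eps0 q0))[N _ /(_ N (leqnn N))] :
  (fun n => k ^+ n) @ \oo --> (0 : R) by apply: cvg_expr; rewrite ger0_norm.
rewrite -ball_normE/= sub0r normrN ger0_norm ?exprn_ge0// ltr_pdivlMr// => kN.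
exists (u N); exists N => // n /= Nn; rewrite ballEmdist/= -(subnKC Nn).
apply: le_lt_trans kN; rewrite (le_trans (geometric_dist_le hk r0 hu _ _))//.
by rewrite ler_wpM2l ?exprn_ge0// lerDl.
Qed.

Definition hardy_rogers {R : realType} {X : metricType R}
    (A B C H E : R) (T : X -> X) : Prop :=
  [/\ [/\ 0 <= A, 0 <= B, 0 <= C, 0 <= H & 0 <= E],
      A + B + C + H + E < 1 &
      forall x y, mdist (T x) (T y) <= A * mdist x y + B * mdist x (T x)
        + C * mdist y (T y) + H * mdist x (T y) + E * mdist y (T x)].

Definition hardy_rogers_rate {R : realType} (A B C H E : R) : R :=
  (2 * A + B + C + H + E) / (2 - (B + C + H + E)).

Section hardy_rogers_theory.
Context {R : realType} {X : metricType R} {A B C H E : R} {T : X -> X}.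

Let kappa := hardy_rogers_rate A B C H E.

(** The numerator minus the denominator is [2 * (A + B + C + H + E) - 2], which is negative. *)
Lemma hardy_rogers_rate_itv : hardy_rogers A B C H E T -> 0 <= kappa < 1.
Proof.
move=> [[A0 B0 C0 H0 E0] sum1 _].
rewrite /kappa /hardy_rogers_rate.
have den_gt0 : 0 < 2 - (B + C + H + E) by lra.
by rewrite divr_ge0 ?ltr_pdivrMr//=; lra.
Qed.

Lemma hardy_rogers_step x :
  hardy_rogers A B C H E T -> mdist (T x) (T (T x)) <= kappa * mdist x (T x).
Proof.
move=> [[A0 B0 C0 H0 E0] sum1 hrT].
(* In the sum of the two instances, [d x (T (T x))] has coefficient [H + E]; the triangle inequality
   splits it into the two consecutive distances, and solving for the second one gives [kappa]. *)
have h1 := hrT x (T x); have h2 := hrT (T x) x.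
have t := metric_triangle x (T x) (T (T x)).
have Ht := ler_wpM2l H0 t; have Et := ler_wpM2l E0 t.
rewrite !mdistxx (metric_sym (T x) x) (metric_sym (T (T x)) (T x)) in h1 h2.
rewrite /kappa /hardy_rogers_rate mulrAC ler_pdivlMr; lra.
Qed.

Lemma hardy_rogers_iter x n : hardy_rogers A B C H E T ->
  mdist (iter n T x) (iter n.+1 T x) <= kappa ^+ n * mdist x (T x).
Proof.
move=> hr; have /andP[k0 _] := hardy_rogers_rate_itv hr.
elim: n => [|n IH]; first by rewrite expr0 mul1r.
rewrite (le_trans (hardy_rogers_step _ hr))//.
by rewrite exprS -mulrA ler_wpM2l.
Qed.

(** At two fixed points the [B] and [C] terms vanish, and the rest is [A + H + E < 1] times their
    distance. *)
Lemma hardy_rogers_fixed_unique x y : hardy_rogers A B C H E T ->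
  T x = x -> T y = y -> y = x.
Proof.
move=> [[A0 B0 C0 H0 E0] sum1 hrT] Tx Ty; apply: mdist_positivity; have := hrT y x.
rewrite Tx Ty !mdistxx (metric_sym x y) => h.
apply/eqP; rewrite eq_le mdist_ge0 andbT leNgt; apply/negP => d0.
have : (A + H + E) * mdist y x < 1 * mdist y x by rewrite ltr_pM2r//; lra.
lra.
Qed.

Lemma hardy_rogers_cvg_fixed x l : hardy_rogers A B C H E T ->
  iter n T x @[n --> \oo] --> l -> T l = l.
Proof.
move=> [[A0 B0 C0 H0 E0] sum1 hrT] /cvg_ballP xl; apply/esym/mdist_positivity/eqP.
rewrite eq_le mdist_ge0 andbT leNgt; apply/negP => d0.
(* With [y] and [T y] within [eps] of [l], the triangle inequalities give [(1 - (B + E)) * d l (T l)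
   <= (1 + A + 2 * C + H + E) * eps]. The left side is [4 * eps]. *)
pose eps := (1 - (B + E)) * mdist l (T l) / 4.
have eps0 : 0 < eps by rewrite divr_gt0// mulr_gt0//; lra.
have [N _ hN] := xl _ eps0.
have := hN N (leqnn N); have := hN N.+1 (leqnSn N); rewrite !ballEmdist/=.
set y := iter N T x => lTy ly; have := hrT l y.
have t1 := metric_triangle l (T y) (T l).
have t2 := metric_triangle y l (T y).
have t3 := metric_triangle y l (T l).
rewrite (metric_sym (T y)) in t1; rewrite !(metric_sym y l) in t2 t3.
have a1 := ler_wpM2l A0 (ltW ly).
have a2 := ler_wpM2l C0 t2; have a3 := ler_wpM2l C0 (ltW ly).
have a4 := ler_wpM2l C0 (ltW lTy); have a5 := ler_wpM2l H0 (ltW lTy).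
have a6 := ler_wpM2l E0 t3; have a7 := ler_wpM2l E0 (ltW ly).
(* The factor is at most 1 plus twice the sum of the coefficients, hence below 3; this contradicts
   [4 * eps]. *)
have : (1 + A + C + C + H + E) * eps < 3 * eps by rewrite ltr_pM2r//; lra.
rewrite /eps in a1 a2 a3 a4 a5 a6 a7 lTy ly eps0 *.
lra.
Qed.

End hardy_rogers_theory.

Theorem corollary3p2 (R : realType) (X : perturbedMetricSpace R)
    (hX : pm_complete X)
    (M : R) (hM : 1 <= M)
    (hDM : forall x y : X, pdist x y <= M * exact_dist x y)
    (T : X -> X) (a b c h e : R)
    (ha : 0 <= a) (hb : 0 <= b) (hc : 0 <= c) (hh : 0 <= h) (he : 0 <= e)
    (hT : forall x y : X,
      pdist (T x) (T y) <= a * pdist x y + b * pdist x (T x)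
        + c * pdist y (T y) + h * pdist x (T y) + e * pdist y (T x))
    (hsum : M * (a + b + c + h + e) < 1) :
  let A := M * a in
  let B := M * b in
  let C := M * c in
  let H := M * h in
  let E := M * e in
  let kappa := (2 * A + B + C + H + E) / (2 - (B + C + H + E)) in
  0 <= kappa < 1 /\
  exists xstar : X,
    [/\ T xstar = xstar,
        (forall y : X, T y = y -> y = xstar) &
        forall x0 : X,
          iter n T x0 @[n --> \oo] --> xstar /\
          forall n : nat,
            exact_dist (iter n T x0) (iter n.+1 T x0)
              <= kappa ^+ n * exact_dist x0 (T x0)].
Proof.
move=> A B C H E kappa.
have M0 : 0 <= M by rewrite (le_trans ler01).
have hr : hardy_rogers A B C H E T.
  split; [by split; exact: mulr_ge0 | by rewrite -!mulrDr | move=> x y].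
  have dD : exact_dist (T x) (T y) <= pdist (T x) (T y).
    by rewrite gerBl perturb_ge0.
  rewrite (le_trans dD)// (le_trans (hT x y))//.
  (* Each term is compared separately, [M] being absorbed into its coefficient. *)
  by rewrite !lerD// /A /B /C /H /E (mulrC M) -mulrA ler_wpM2l//; exact: hDM.
have rate : 0 <= kappa < 1 by exact: hardy_rogers_rate_itv hr.
have step x := hardy_rogers_iter x ^~ hr.
have lim x : exists l : X, iter n T x @[n --> \oo] --> l.
  exact: hX (geometric_cauchy rate (step x)).
split=> //; have [x1] := pm_nonempty X; have [l x1l] := lim x1.
have fixl := hardy_rogers_cvg_fixed _ _ hr x1l.
have uniql y := hardy_rogers_fixed_unique l y hr fixl.
exists l; split=> // x0; split; last exact: step.
(* The limit [m] of any other Picard sequence is fixed too, so uniqueness identifies it with [l]. *)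
have [m x0m] := lim x0; rewrite -(uniql m)//.
exact: hardy_rogers_cvg_fixed hr x0m.
Qed.
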